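(* Let $(\Omega,\mathcal A,\mu)$ be a $\sigma$-finite and atom-free measure space. Let $0\ne u\in L^1(\Omega)$ and $K\in(0,\mu(\Omega))$. Then $$\partial|\cdot|_K(0)=\{s\in L^\infty(\Omega)\mid \|s\|_\infty\le1,\ \|s\|_1\le K\},$$ $$\partial|\cdot|_K(u)=\Big\{s\in L^\infty(\Omega)\ \Big|\ \max\big(\|s\|_\infty,\,K^{-1}\|s\|_1\big)=1,\ \int_\Omega s\,u\,d\mu=|u|_K\Big\}.$$
   Context: A set $A\in\mathcal A$ with $\mu(A)>0$ is an atom if every $B\in\mathcal A$ with $B\subseteq A$ satisfies $\mu(B)=0$ or $\mu(A\setminus B)=0$; the measure space is atom-free if it has no atoms. The largest-$K$-norm is $|u|_K:=\sup_{A\in\mathcal A:\ \mu(A)\le K}\int_A|u|\,d\mu$ for $u\in L^1(\Omega)$. The convex subdifferential is taken in $L^1(\Omega)$, with $L^1(\Omega)'$ identified with $L^\infty(\Omega)$: $\partial|\cdot|_K(u)=\{s\in L^\infty(\Omega)\mid |v|_K-|u|_K\ge\int_\Omega s(v-u)\,d\mu\ \ \forall v\in L^1(\Omega)\}$. For $s \in L^\infty(\Omega)$, $\|s\|_1=\int_\Omega|s|\,d\mu\in[0,\infty]$. *)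

(* Defs.v *)
From HB Require Import structures.
From mathcomp Require Import all_boot all_order all_algebra.
From mathcomp Require Import all_classical all_reals all_analysis.

Set Implicit Arguments.
Unset Strict Implicit.
Unset Printing Implicit Defensive.

Import Order.TTheory GRing.Theory Num.Theory.
Import numFieldNormedType.Exports.

Local Open Scope classical_set_scope.
Local Open Scope ring_scope.
Local Open Scope ereal_scope.

(* Elements of L^1 and L^oo are represented by measurable real functions of
   finite norm, so equality in these spaces is equality almost everywhere.
   All notions below are invariant under it. *)
Notation L1fun mu := (LfunType mu (lexx 1)).
Notation Linfty_fun mu := (LfunType mu (leey 1)).

Definition atom d (T : measurableType d) (R : realType)
    (mu : {measure set T -> \bar R}) (A : set T) : Prop :=
  [/\ measurable A, 0 < mu A &
      forall B, measurable B -> B `<=` A -> mu B = 0 \/ mu (A `\` B) = 0].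

Definition atom_free d (T : measurableType d) (R : realType)
    (mu : {measure set T -> \bar R}) : Prop :=
  forall A : set T, ~ atom mu A.

Definition largestK_norm d (T : measurableType d) (R : realType)
    (mu : {measure set T -> \bar R}) (K : R) (u : L1fun mu) : \bar R :=
  ereal_sup [set \int[mu]_(x in A) `|u x|%:E
            | A in [set A | measurable A /\ mu A <= K%:E]].

(* Intended for finite-valued J, such as largestK_norm (which is bounded by the
   L^1 norm), so that the difference J v - J u is never oo - oo. *)
Definition subdifferential d (T : measurableType d) (R : realType)
    (mu : {measure set T -> \bar R}) (J : L1fun mu -> \bar R) (u : L1fun mu) :
    set (Linfty_fun mu) :=
  [set s | forall v : L1fun mu,
     J v - J u >= \int[mu]_x (s x * (v - u)%R x)%:E].

(* Main.v *)
(* The ball {s | |s|_oo <= c, |s|_1 <= c K} is c times the dual unit ball of the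
   largest-K-norm.  If s lies in it, then \int |s v| <= c |v|_K by the bathtub
   principle: with a level t of |v| and, since mu has no atoms, a set A of
   measure exactly K (at most K if t = 0), {|v| > t} `<=` A `<=` {|v| >= t},
   integrate  |s| |v| + c t 1_A <= c |v| 1_A + t |s|.
   Conversely, testing \int s v <= |v|_K on v = sign(s) 1_B gives
   \int_B |s| <= min(mu B, K) for every B of finite measure, whence both bounds.
   For u != 0, the triangle inequality turns a subgradient at u into an element
   of the dual ball attaining |u|_K > 0; were its norm c < 1, the bathtub bound
   would give |u|_K <= c |u|_K. *)
Require Import Defs.
From HB Require Import structures.
From mathcomp Require Import all_boot all_order all_algebra.
From mathcomp Require Import all_classical all_reals all_analysis.
From mathcomp Require Import measurable_realfun ess_sup_inf lra.

Set Implicit Arguments.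
Unset Strict Implicit.
Unset Printing Implicit Defensive.

Import Order.TTheory GRing.Theory Num.Theory.
Import numFieldNormedType.Exports.

Local Open Scope classical_set_scope.
Local Open Scope ring_scope.
Local Open Scope ereal_scope.

(** * Sets of prescribed measure in atom-free spaces *)

Lemma measure_setDU d (T : measurableType d) (R : realType)
    (mu : {measure set T -> \bar R}) (A B : set T) :
  measurable A -> measurable B -> A `<=` B -> mu B = mu A + mu (B `\` A).
Proof.
move=> mA mB AB; rewrite -measureU ?setDUK// ?setDIK//; exact: measurableD.
Qed.

(** Since [F] is not an atom, it splits into two non-null parts, and the smaller one is the desired
    set. Writing the bound as a sum avoids dividing in the extended reals and also covers
    [mu F = +oo]. *)
Lemma atom_free_halve d (T : measurableType d) (R : realType)
    (mu : {measure set T -> \bar R}) (F : set T) :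
  atom_free mu -> measurable F -> 0 < mu F ->
  exists B, [/\ measurable B, B `<=` F, 0 < mu B & mu B + mu B <= mu F].
Proof.
move=> af mF F0.
have [B [mB BF B0 FB0]] : exists B,
    [/\ measurable B, B `<=` F, mu B <> 0 & mu (F `\` B) <> 0].
  apply: contrapT => H; apply: (af F); split => // B mB BF.
  have [B0|B0] := pselect (mu B = 0); first by left.
  by right; apply: contrapT => FB0; apply: H; exists B.
have E := measure_setDU mu mB mF BF.
have [le|/ltW le] := leP (mu B) (mu (F `\` B)).
  by exists B; split => //; [rewrite lt0e measure_ge0 andbT; apply/eqP|
    rewrite E leeD].
exists (F `\` B); split; [exact: measurableD|by move=> x []| |].
  by rewrite lt0e measure_ge0 andbT; exact/eqP.
by rewrite E leeD.
Qed.

(** Repeated halving: once [2 ^+ n] exceeds [mu F / e], [n] halvings bring the measure down to [e].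
    The exponent chosen works because [n < 2 ^ n]. *)
Lemma atom_free_small d (T : measurableType d) (R : realType)
    (mu : {measure set T -> \bar R}) (F : set T) (e : R) :
  atom_free mu -> measurable F -> 0 < mu F -> mu F < +oo -> (0 < e)%R ->
  exists B, [/\ measurable B, B `<=` F, 0 < mu B & mu B <= e%:E].
Proof.
move=> af mF F0 Foo e0.
suff H n : forall F, measurable F -> 0 < mu F -> mu F <= (e * 2 ^+ n)%:E ->
    exists B, [/\ measurable B, B `<=` F, 0 < mu B & mu B <= e%:E].
  apply: (H (Num.truncn (fine (mu F) / e)).+1) => //.
  rewrite -[mu F]fineK ?ge0_fin_numE// lee_fin -ler_pdivrMl// mulrC.
  apply: le_trans (ltW (truncnS_gt _)) _.
  by rewrite -natrX ler_nat ltnW// ltn_expl.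
elim: n => [|n IH] {mF F0 Foo}F mF F0.
  by rewrite expr0 mulr1 => Fe; exists F; split.
move=> Fe; have [B [mB BF B0 BB]] := atom_free_halve af mF F0.
have [|C [mC CB C0 Ce]] := IH B mB B0; last first.
  by exists C; split => //; exact: subset_trans BF.
have : mu B + mu B <= (e * 2 ^+ n.+1)%:E by exact: le_trans Fe.
case: (mu B) => [b| |]//; last by move=> _; rewrite leNye.
by rewrite -EFinD !lee_fin exprS => h; lra.
Qed.

(** Some piece of a countable cover by sets of finite measure meets [F] in positive measure, as
    otherwise [F] would be null. The finite case applies to that intersection. *)
Lemma sigma_finite_atom_free_small d (T : measurableType d) (R : realType)
    (mu : {sigma_finite_measure set T -> \bar R}) (F : set T) (e : R) :
  atom_free mu -> measurable F -> 0 < mu F -> (0 < e)%R ->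
  exists B, [/\ measurable B, B `<=` F, 0 < mu B & mu B <= e%:E].
Proof.
move=> af mF F0 e0.
have [G GT mG] := sigma_finiteT mu.
have [n Gn] : exists n, 0 < mu (F `&` G n).
  apply: contrapT => H; move: F0; suff -> : mu F = 0 by rewrite ltxx.
  rewrite -[F]setIT GT setI_bigcupr; apply: measure_negligible.
    apply: bigcupT_measurable => n.
    by apply: measurableI => //; exact: (mG n).1.
  apply: negligible_bigcup => n; apply/negligibleP.
    by apply: measurableI => //; exact: (mG n).1.
  apply/eqP; rewrite eq_le measure_ge0 andbT leNgt; apply/negP => ?.
  by apply: H; exists n.
have mFG : measurable (F `&` G n) by apply: measurableI => //; exact: (mG n).1.
have [|B [mB BF B0 Be]] := atom_free_small af mFG Gn _ e0.
  apply: le_lt_trans (mG n).2; apply: le_measure; rewrite ?inE//.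
  exact: (mG n).1.
by exists B; split => // x /BF[].
Qed.

(** The supremum of [m] over admissible supersets of [A] may not be attained, but some superset
    realizes at least half of the possible gain. The premise [st A] sits under the existential so
    that the axiom of choice yields a total function on sets, ready to be iterated. *)
Lemma greedy_extension (T : Type) (R : realType) (m : set T -> R)
    (st : set T -> Prop) (c : R) :
  (forall C, st C -> (m C <= c)%R) ->
  forall A, exists B, st A ->
    [/\ st B, A `<=` B &
      forall C, st C -> A `<=` C -> (m C - m A <= 2 * (m B - m A))%R].
Proof.
move=> mc A; have [sA|nsA] := pselect (st A); last by exists A.
pose S := [set m C | C in [set C | st C /\ A `<=` C]].
have hS : has_sup S.
  split; first by exists (m A), A => //; split.
  by exists c => _ [C [sC _] <-]; exact: mc.
have leS C : st C -> A `<=` C -> (m C <= sup S)%R.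
  by move=> sC AC; apply: ub_le_sup; [exact: hS.2|exists C].
have [supA|Asup] := leP (sup S) (m A).
  exists A => _; split => [|x|C sC AC] //.
  by have := leS C sC AC; lra.
have e0 : (0 < (sup S - m A) / 2)%R by lra.
have [_ [B [sB AB] <-] supB] := sup_adherent e0 hS.
exists B => _; split => // C sC AC.
by have := leS C sC AC; lra.
Qed.

(* Greedy exhaustion: if the union U of the greedy chain had measure < c, a set
   D of small positive measure in F `\` U could be added at every step, so each
   step would gain at least mu D / 2. *)
Lemma atom_free_intermediate_measure d (T : measurableType d) (R : realType)
    (mu : {measure set T -> \bar R}) (F : set T) (c : R) :
  atom_free mu -> measurable F -> mu F < +oo -> (0 <= c)%R -> c%:E <= mu F ->
  exists A, [/\ measurable A, A `<=` F & mu A = c%:E].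
Proof.
move=> af mF Foo c0 cF.
pose st A := [/\ measurable A, A `<=` F & mu A <= c%:E].
pose m A := fine (mu A).
have mE A : st A -> mu A = (m A)%:E.
  by case=> mA AF Ac; rewrite fineK// ge0_fin_numE// (le_lt_trans Ac)// ltry.
have mc C : st C -> (m C <= c)%R.
  by move=> sC; rewrite -lee_fin -mE//; case: sC.
have [f fP] := boolp.choice (greedy_extension mc).
pose A n := iter n f set0.
have sA n : st (A n).
  elim: n => [|n /fP[]//].
  by split => //=; rewrite measure0 lee_fin.
have AS n : A n `<=` A n.+1 by have [] := fP _ (sA n).
have mA n : measurable (A n) by have [] := sA n.
pose U := \bigcup_n A n.
have mU : measurable U by exact: bigcupT_measurable.
have UF : U `<=` F by move=> x [n _]; have [_ + _] := sA n; apply.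
have Uc : mu U <= c%:E.
  have ndA : {homo A : n k / (n <= k)%N >-> (n <= k)%O}.
    by apply/nondecreasing_seqP => n; rewrite subsetEset.
  have cvgA : mu (A n) @[n --> \oo] --> mu U := nondecreasing_cvg_mu mA mU ndA.
  rewrite -(cvg_lim _ cvgA)//; apply: lime_le.
    by apply/cvg_ex; exists (mu U).
  by apply: nearW => n; have [] := sA n.
have sU : st U by [].
have [Uc'|cU] := leP c%:E (mu U).
  by exists U; split => //; apply/eqP; rewrite eq_le Uc.
have mFU : measurable (F `\` U) by exact: measurableD.
(* The bound [c - m U] lets [D] be added to [U], hence to every [A n], without exceeding [c]. *)
have [|||D [mD DFU D0 Dc]] :=
    @atom_free_small _ _ _ mu (F `\` U) (c - m U) af mFU.
- rewrite lt0e measure_ge0 andbT; apply/eqP => FU0.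
  move: cF; rewrite (measure_setDU mu mU mF UF) FU0 adde0.
  by rewrite leNgt cU.
- apply: le_lt_trans Foo; apply: le_measure; rewrite ?inE//.
- by rewrite subr_gt0 -lte_fin -mE.
have sD : st D.
  split => //; first by move=> x /DFU[].
  apply: le_trans Dc _; rewrite lee_fin lerBlDr lerDl fine_ge0//.
have step n : (m D <= 2 * (m (A n.+1) - m (A n)))%R.
  have ADE : mu (A n `|` D) = mu (A n) + mu D.
    rewrite measureU// -subset0 => x [Anx /DFU[_]]; apply; exists n => //.
  have AU : mu (A n) <= mu U.
    by apply: le_measure; rewrite ?inE// => x Anx; exists n.
  have sAD : st (A n `|` D).
    split; first exact: measurableU.
      by move=> x [|/DFU[]//]; have [_ + _] := sA n; apply.
    rewrite ADE; apply: le_trans (leeD AU Dc) _.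
    by rewrite (mE U sU) -EFinD subrKC.
  have [_ _ /(_ _ sAD (@subsetUl _ _ _))] := fP _ (sA n).
  have -> : m (A n `|` D) = (m (A n) + m D)%R.
    by apply: EFin_inj; rewrite -mE// ADE EFinD -!mE.
  by rewrite -[f _]/(A n.+1); lra.
have mD0 : (0 < m D)%R by rewrite -lte_fin -mE.
have grow n : (n%:R * m D <= 2 * m (A n))%R.
  elim: n => [|n IH]; first by rewrite mul0r mulr_ge0// fine_ge0.
  by have := step n; rewrite -natr1; lra.
(* All [m (A n)] are at most [c], so linear growth fails as soon as [n] exceeds [2 * c / m D]. *)
have := grow (Num.truncn (2 * c / m D)).+1.
rewrite leNgt; case/negP.
apply: (@le_lt_trans _ _ (2 * c)%R); first by rewrite ler_pM2l// mc.
by rewrite -ltr_pdivrMr// truncnS_gt.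
Qed.

(** * The bathtub set *)

(* t is the infimum of the levels whose strict superlevel set has measure at
   most K. *)
Lemma bathtub_set d (T : measurableType d) (R : realType)
    (mu : {measure set T -> \bar R}) (f : T -> R) (K : R) :
  atom_free mu -> (0 < K)%R -> measurable_fun setT f ->
  (forall x, 0 <= f x)%R -> \int[mu]_x (f x)%:E < +oo ->
  exists t A, [/\ measurable A, mu A <= K%:E, (0 <= t)%R,
    t = 0%R \/ mu A = K%:E &
    forall x, (A x -> t <= f x)%R /\ (~ A x -> f x <= t)%R].
Proof.
move=> af K0 mf f0 foo.
pose G t := [set x | t < f x]%R.
have mG t : measurable (G t).
  by rewrite /G -preimage_itvoy -[X in measurable X]setTI; exact: mf.
have GS s t : (s <= t)%R -> G t `<=` G s.
  by move=> st x; rewrite /G/=; exact: le_lt_trans.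
have markov t : (0 < t)%R -> t%:E * mu (G t) <= \int[mu]_x (f x)%:E.
  move=> t0; have /measurable_EFinP mEf := mf.
  (* Markov's inequality, with the identity as the nondecreasing function. *)
  have := le_integral_comp_abse mu measurableT (@measurable_id _ _ setT)
    (fun r r0 => r0) (fun _ _ _ _ h => h) mEf t0.
  under eq_integral do rewrite /= ger0_norm//.
  apply: le_trans; rewrite lee_pmul2l//; apply: le_measure; rewrite ?inE//.
    rewrite setTI; under eq_set do rewrite /= ger0_norm// lee_fin.
    by rewrite -preimage_itvcy -[X in measurable X]setTI; exact: mf.
  by move=> x /ltW tx; split => //=; rewrite lee_fin ger0_norm.
have Goo t : (0 < t)%R -> mu (G t) < +oo.
  move=> t0; have := le_lt_trans (markov t t0) foo.
  by case: (mu (G t)) => [r| |]//; rewrite ?ltry// gt0_muley// ltxx.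
pose S := [set t | (0 <= t)%R /\ mu (G t) <= K%:E].
have hS : has_inf S.
  split; last by exists 0%R => t [].
  set M := fine (\int[mu]_x (f x)%:E).
  have M0 : (0 <= M)%R.
    by rewrite fine_ge0// integral_ge0// => x _; rewrite lee_fin.
  (* By Markov, the superlevel set at [(M + 1) / K] has measure at most [M * K / (M + 1) <= K];
     adding 1 keeps the level positive when [M = 0]. *)
  have t0 : (0 < (M + 1) / K)%R by rewrite divr_gt0// ltr_wpDl.
  exists ((M + 1) / K)%R; split; first exact: ltW.
  have := markov _ t0.
  have -> : \int[mu]_x (f x)%:E = M%:E.
    by rewrite fineK// ge0_fin_numE// integral_ge0// => x _; rewrite lee_fin.
  case: (mu (G _)) (Goo _ t0) => [r| |]// _; last by move=> _; rewrite leNye.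
  by rewrite -EFinM !lee_fin mulrAC ler_pdivrMr// => h; nra.
pose t := inf S.
have t0 : (0 <= t)%R by apply: lb_le_inf; [exact: hS.1|move=> s []].
(* Continuity from below: [G t] is the increasing union of superlevel sets at levels strictly above
   the infimum, each of measure at most [K]. *)
have GtK : mu (G t) <= K%:E.
  pose F n := G (t + n.+1%:R^-1)%R.
  have FE : \bigcup_n F n = G t.
    rewrite eqEsubset; split => [x [n _]|x].
      by rewrite /F /G/=; apply: le_lt_trans; rewrite lerDl invr_ge0.
    by rewrite /G/= => /ltr_add_invr[k tk]; exists k.
  have ndF : {homo F : n k / (n <= k)%N >-> (n <= k)%O}.
    move=> n k nk; rewrite subsetEset; apply: GS.
    by rewrite lerD2l lef_pV2 ?posrE// ler_nat.
  have cF : mu (F n) @[n --> \oo] --> mu (G t).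
    rewrite -FE; apply: nondecreasing_cvg_mu => //; rewrite ?FE// => n.
    exact: mG.
  rewrite -(cvg_lim _ cF)//; apply: lime_le.
    by apply/cvg_ex; exists (mu (G t)).
  apply: nearW => n.
  have n0 : (0 < n.+1%:R^-1 :> R)%R by rewrite invr_gt0.
  have [s [_ sK] st] := inf_adherent n0 hS.
  by apply: le_trans sK; apply: le_measure; rewrite ?inE;
    [exact: mG|exact: mG|apply: GS; exact: ltW].
have [t_eq0|t_neq0] := eqVneq t 0%R.
  exists t, (G t); split => //; first by left.
  by move=> x; split => [/ltW//|/negP]; rewrite /G/= -leNgt.
have {t_neq0}t_gt0 : (0 < t)%R by rewrite lt_neqAle eq_sym t_neq0.
pose H := [set x | t <= f x]%R.
have mH : measurable H.
  by rewrite /H -preimage_itvcy -[X in measurable X]setTI; exact: mf.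
have GH : G t `<=` H by move=> x /ltW.
have HG s : (s < t)%R -> H `<=` G s by move=> st x; exact: lt_le_trans.
have t2 : (0 < t / 2)%R by rewrite divr_gt0.
have Hoo : mu H < +oo.
  apply: le_lt_trans (Goo _ t2).
  by apply: le_measure; rewrite ?inE//; apply: HG; lra.
(* Continuity from above: the levels increase strictly to [t] from below, so none lies in [S] and
   each superlevel set has measure above [K]. The factor [t / 2] keeps the levels positive, so that
   the first set has finite measure. *)
have KH : K%:E <= mu H.
  pose F n := G (t - t / 2 * n.+1%:R^-1)%R.
  have FE : \bigcap_n F n = H.
    rewrite eqEsubset; split => [x Fx|x Hx n _]; last first.
      by apply: HG Hx; rewrite ltrBlDr ltrDl mulr_gt0.
    rewrite /H/= leNgt; apply/negP => xt.
    have : (0 < (t - f x) / (t / 2))%R by rewrite divr_gt0// subr_gt0.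
    move=> /ltr_add_invr[k]; rewrite add0r ltr_pdivlMr// => h.
    by have := Fx k I; rewrite /F /G/= ltrBlDr -ltrBlDl ltNge mulrC ltW.
  have niF : {homo F : n k / (n <= k)%N >-> (k <= n)%O}.
    move=> n k nk; rewrite subsetEset; apply: GS.
    by rewrite lerD2l lerN2 ler_pM2l// lef_pV2 ?posrE// ler_nat.
  have cF : mu (F n) @[n --> \oo] --> mu H.
    rewrite -FE; apply: nonincreasing_cvg_mu => //; rewrite ?FE//.
      by apply: Goo; rewrite invr1; lra.
    by move=> n; exact: mG.
  rewrite -(cvg_lim _ cF)//; apply: lime_ge.
    by apply/cvg_ex; exists (mu H).
  apply: nearW => n; rewrite leNgt; apply/negP => /ltW FK.
  have lt_t : (t - t / 2 * n.+1%:R^-1 < t)%R by rewrite ltrBlDr ltrDl mulr_gt0.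
  have : (t <= t - t / 2 * n.+1%:R^-1)%R.
    apply: ge_inf; first exact: hS.2.
    split => //; rewrite subr_ge0.
    apply: (@le_trans _ _ (t / 2)%R); last by lra.
    by rewrite ler_piMr ?(ltW t2)// invf_le1 ?ler1n.
  by rewrite leNgt lt_t.
have mHG : measurable (H `\` G t) by exact: measurableD.
have HE := measure_setDU mu (mG t) mH GH.
have [g GtE] : exists g, mu (G t) = g%:E.
  exists (fine (mu (G t))).
  by rewrite fineK// ge0_fin_numE// (le_lt_trans GtK)// ltry.
(* The missing mass [K - g] is taken from the level set where [f] equals [t]. *)
have [|||B [mB BHG BE]] :=
  @atom_free_intermediate_measure _ _ _ mu (H `\` G t) (K - g) af mHG.
- by apply: le_lt_trans Hoo; rewrite HE leeDr.
- by rewrite subr_ge0 -lee_fin -GtE.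
- by rewrite EFinB leeBlDl// -GtE -HE.
have AE : mu (G t `|` B) = K%:E.
  transitivity (mu (G t) + mu B); last by rewrite BE GtE -EFinD subrKC.
  by apply: measureU => //; rewrite -subset0 => x [Gx /BHG[]].
exists t, (G t `|` B); split => //; first exact: measurableU.
- by rewrite AE.
- by right.
- move=> x; split => [[/ltW//|/BHG[]//]|/not_orP[/negP + _]].
  by rewrite /G/= -leNgt.
Qed.

(** * Elementary properties of integrals and of the largest-K-norm *)

Lemma integral_mul_indic d (T : measurableType d) (R : realType)
    (mu : {measure set T -> \bar R}) (A : set T) (f : T -> R) :
  \int[mu]_(x in A) (f x)%:E = \int[mu]_x (f x * \1_A x)%:E.
Proof.
rewrite integral_mkcond; apply: eq_integral => x _.
by rewrite patchE indicE; case: ifPn; rewrite ?mulr1 ?mulr0.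
Qed.

Lemma integral_gt0 d (T : measurableType d) (R : realType)
    (mu : {measure set T -> \bar R}) (B : set T) (f : T -> R) :
  measurable B -> 0 < mu B -> measurable_fun setT f ->
  (forall x, B x -> 0 < f x)%R -> 0 < \int[mu]_(x in B) (f x)%:E.
Proof.
move=> mB B0 mf f0; rewrite lt0e integral_ge0 ?andbT; last first.
  by move=> x /f0/ltW; rewrite lee_fin.
apply/eqP => I0.
have mfB : measurable_fun B (EFin \o f).
  by apply/measurable_EFinP; exact: measurable_funS mf.
have /(ae_eq_integral_abs mu mB mfB) : \int[mu]_(x in B) `|(EFin \o f) x| = 0.
  rewrite -[RHS]I0; apply: eq_integral => x; rewrite inE => Bx.
  by rewrite /= ger0_norm// ltW// f0.
move=> [N [mN N0 subN]].
suff : mu B <= mu N by rewrite N0 leNgt B0.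
apply: le_measure; rewrite ?inE// => x Bx; apply: subN => /= /(_ Bx) [fx0].
by have := f0 _ Bx; rewrite fx0 ltxx.
Qed.

Lemma L1fun_integral_lty d (T : measurableType d) (R : realType)
    (mu : {measure set T -> \bar R}) (v : L1fun mu) :
  \int[mu]_x `|v x|%:E < +oo.
Proof.
have : finite_norm mu 1 v by exact: Lfunction_finite.
by rewrite /finite_norm Lnorm1.
Qed.

Lemma largestK_norm_ge d (T : measurableType d) (R : realType)
    (mu : {measure set T -> \bar R}) (K : R) (v : L1fun mu) (A : set T) :
  measurable A -> mu A <= K%:E ->
  \int[mu]_(x in A) `|v x|%:E <= largestK_norm K v.
Proof. by move=> mA AK; apply: ereal_sup_ubound; exists A. Qed.

Lemma largestK_norm_le d (T : measurableType d) (R : realType)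
    (mu : {measure set T -> \bar R}) (K : R) (v : L1fun mu) (y : \bar R) :
  (forall A, measurable A -> mu A <= K%:E ->
    \int[mu]_(x in A) `|v x|%:E <= y) -> largestK_norm K v <= y.
Proof. by move=> H; apply: ge_ereal_sup => _ [A [mA AK] <-]; exact: H. Qed.

Lemma measurable_norm_L1 d (T : measurableType d) (R : realType)
    (mu : {measure set T -> \bar R}) (v : L1fun mu) (D : set T) :
  measurable_fun D (fun x => `|v x|%:E).
Proof.
by apply/measurable_EFinP/measurable_funTS/measurableT_comp.
Qed.

Lemma largestK_norm_ge0 d (T : measurableType d) (R : realType)
    (mu : {measure set T -> \bar R}) (K : R) (v : L1fun mu) :
  (0 < K)%R -> 0 <= largestK_norm K v.
Proof.
move=> K0; have := @largestK_norm_ge _ _ _ mu K v set0 measurable0.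
by rewrite measure0 lee_fin integral_set0; apply; exact: ltW.
Qed.

Lemma largestK_norm_fin d (T : measurableType d) (R : realType)
    (mu : {measure set T -> \bar R}) (K : R) (v : L1fun mu) :
  (0 < K)%R -> largestK_norm K v \is a fin_num.
Proof.
move=> K0; rewrite ge0_fin_numE ?largestK_norm_ge0//.
apply: le_lt_trans (L1fun_integral_lty v); apply: largestK_norm_le => A mA _.
by apply: ge0_subset_integral => //; exact: measurable_norm_L1.
Qed.

Lemma largestK_norm0 d (T : measurableType d) (R : realType)
    (mu : {measure set T -> \bar R}) (K : R) :
  (0 < K)%R -> largestK_norm K (0%R : L1fun mu) = 0.
Proof.
move=> K0; apply/eqP; rewrite eq_le largestK_norm_ge0// andbT.
apply: largestK_norm_le => A mA _.
by under eq_integral do rewrite normr0; rewrite integral0.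
Qed.

Lemma largestK_normD d (T : measurableType d) (R : realType)
    (mu : {measure set T -> \bar R}) (K : R) (u v : L1fun mu) :
  largestK_norm K (u + v)%R <= largestK_norm K u + largestK_norm K v.
Proof.
apply: largestK_norm_le => A mA AK.
apply: le_trans (leeD (largestK_norm_ge u mA AK) (largestK_norm_ge v mA AK)).
rewrite -ge0_integralD//; [|exact: measurable_norm_L1..].
apply: ge0_le_integral => //; first exact: measurable_norm_L1.
- by apply: emeasurable_funD; exact: measurable_norm_L1.
- by move=> x _; rewrite -EFinD lee_fin ler_normD.
Qed.

(** The set where [u] is nonzero may be too large to compete in the supremum, but it contains a
    non-null set of measure at most [K], on which [|u|] has positive integral. *)
Lemma largestK_norm_gt0 d (T : measurableType d) (R : realType)
    (mu : {sigma_finite_measure set T -> \bar R}) (K : R) (u : L1fun mu) :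
  atom_free mu -> (0 < K)%R -> ~ ae_eq mu setT u (cst 0%R) ->
  0 < largestK_norm K u.
Proof.
move=> af K0 u0.
pose F := [set x | 0 < `|u x|]%R.
have mu_u : measurable_fun setT (fun x => `|u x|%R).
  by apply: measurableT_comp.
have mF : measurable F.
  by rewrite /F -preimage_itvoy -[X in measurable X]setTI; exact: mu_u.
have F0 : 0 < mu F.
  rewrite lt0e measure_ge0 andbT; apply/eqP => F0; apply: u0.
  exists F; split => // x /= ux; rewrite /F/= normr_gt0; apply/eqP => ux0.
  by apply: ux.
have [B [mB BF B0 BK]] := sigma_finite_atom_free_small af mF F0 K0.
apply: lt_le_trans (largestK_norm_ge u mB BK).
exact: integral_gt0.
Qed.

(** * The duality inequality *)

Lemma integral_abs_le_largestK_norm d (T : measurableType d) (R : realType)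
    (mu : {measure set T -> \bar R}) (K c : R) (s : T -> R) (v : L1fun mu) :
  atom_free mu -> (0 < K)%R -> (0 <= c)%R -> measurable_fun setT s ->
  (\forall x \ae mu, `|s x| <= c)%R -> \int[mu]_x `|s x|%:E <= (c * K)%:E ->
  \int[mu]_x `|s x * v x|%:E <= c%:E * largestK_norm K v.
Proof.
move=> af K0 c0 ms sc scK.
have mv : measurable_fun setT (fun x => `|v x|%R) by apply: measurableT_comp.
have mas : measurable_fun setT (fun x => `|s x|%R) by apply: measurableT_comp.
have [t [A [mA AK t0 tAK vA]]] :=
  bathtub_set af K0 mv (fun=> normr_ge0 _) (L1fun_integral_lty v).
have m1A : measurable_fun setT (\1_A : T -> R) by exact: measurable_indic.
(* Although [A] may have measure below [K] when [t = 0], both sides then vanish. *)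
have tAE : t%:E * mu A = (t * K)%:E.
  by case: tAK => [->|->]; rewrite ?mul0e ?mul0r.
have ct0 : (0 <= c * t)%R by exact: mulr_ge0.
have msv : measurable_fun setT (fun x => `|s x * v x|%R).
  by apply: measurableT_comp => //; exact: measurable_funM.
have mct : measurable_fun setT (fun x => c * t * \1_A x)%R.
  exact: measurable_funM.
have mcv : measurable_fun setT (fun x => c * (`|v x| * \1_A x))%R.
  by apply: measurable_funM => //; exact: measurable_funM.
have mts : measurable_fun setT (fun x => t * `|s x|)%R.
  exact: measurable_funM.
have ind01 x : (0 <= \1_A x :> R)%R by rewrite indicE.
(* On [A] the pointwise inequality is [(c - |s|) (|v| - t) >= 0]; off [A] it is
   [|s| (t - |v|) >= 0]. The terms are arranged so that both integrands are nonnegative and no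
   subtraction of integrals arises. *)
have key : \int[mu]_x (`|s x * v x|%:E + (c * t * \1_A x)%:E) <=
           \int[mu]_x ((c * (`|v x| * \1_A x))%:E + (t * `|s x|)%:E).
  apply: ae_ge0_le_integral => //.
  - by move=> x _; rewrite -EFinD lee_fin addr_ge0// mulr_ge0.
  - by apply: emeasurable_funD; exact/measurable_EFinP.
  - by move=> x _; rewrite -EFinD lee_fin addr_ge0// !mulr_ge0.
  - by apply: emeasurable_funD; exact/measurable_EFinP.
  - apply: filterS sc => x sxc _; rewrite -!EFinD lee_fin normrM indicE.
    have [tv vt] := vA x.
    have [xA|xA] := boolP (x \in A).
      have {}tv := tv (set_mem xA).
      by rewrite !mulr1; nra.
    have {}vt : (`|v x| <= t)%R by apply: vt => Ax; rewrite mem_set in xA.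
    by rewrite !mulr0 addr0 add0r mulrC ler_wpM2r.
(* The finite integral of [c t 1_A] is added to both sides of the goal, to match [key]. *)
have cK_fin : (c * t * K)%:E \is a fin_num by [].
rewrite -(leeD2rE _ _ cK_fin).
have E1 : \int[mu]_x (c * t * \1_A x)%:E = (c * t * K)%:E.
  under eq_integral do rewrite EFinM.
  rewrite ge0_integralZl_EFin//; last exact/measurable_EFinP.
  by rewrite integral_indic// setIT -mulrA EFinM -muleA tAE -EFinM.
have E2 : \int[mu]_x (c * (`|v x| * \1_A x))%:E =
    c%:E * \int[mu]_(x in A) `|v x|%:E.
  rewrite (integral_mul_indic mu A) -ge0_integralZl_EFin//.
  by apply/measurable_EFinP; exact: measurable_funM.
have E3 : \int[mu]_x (t * `|s x|)%:E = t%:E * \int[mu]_x `|s x|%:E.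
  rewrite -ge0_integralZl_EFin//.
  exact/measurable_EFinP.
move: key; rewrite ge0_integralD//; last 3 first.
- exact/measurable_EFinP.
- by move=> x _; rewrite lee_fin mulr_ge0.
- exact/measurable_EFinP.
rewrite E1 => /le_trans; apply.
rewrite ge0_integralD//; last 4 first.
- by move=> x _; rewrite lee_fin !mulr_ge0.
- exact/measurable_EFinP.
- by move=> x _; rewrite lee_fin mulr_ge0.
- exact/measurable_EFinP.
rewrite E2 E3; apply: leeD.
  by apply: lee_wpmul2l; [rewrite lee_fin|exact: largestK_norm_ge].
rewrite (_ : c * t * K = t * (c * K))%R; last by rewrite mulrA (mulrC t).
by rewrite (EFinM t); apply: lee_wpmul2l; rewrite ?lee_fin.
Qed.

(** * Testing with signed indicators *)

Lemma signed_indic d (T : measurableType d) (R : realType)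
    (mu : {measure set T -> \bar R}) (s : T -> R) (B : set T) :
  measurable_fun setT s -> measurable B -> mu B < +oo ->
  exists v : L1fun mu, forall x,
    (`|v x| = \1_B x)%R /\ (s x * v x = `|s x| * \1_B x)%R.
Proof.
move=> ms mB Boo.
(* Where [s] vanishes the sign is taken to be -1, which keeps [|f|] equal to the indicator and does
   not affect the product. *)
pose f x : R := if (0 < s x)%R then \1_B x else (- \1_B x)%R.
have nf x : (`|f x| = \1_B x)%R.
  by rewrite /f; case: ifP; rewrite ?normrN ger0_norm// indicE.
have m1B : measurable_fun setT (\1_B : T -> R) by exact: measurable_indic.
have mf : measurable_fun setT f.
  apply: measurable_fun_ifT => //; first exact: measurable_fun_ltr.
  exact: measurableT_comp.
have fL : f \in Lfun mu 1.
  apply/Lfun1_integrable/integrableP; split; first exact/measurable_EFinP.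
  under eq_integral do rewrite /= nf.
  by rewrite integral_indic// setIT.
exists (Lfun_Sub (lexx 1) fL) => x; split; first exact: nf.
rewrite Lfun_valP /f; case: ltP => [/gtr0_norm->//|/ler0_norm->].
by rewrite mulrN mulNr.
Qed.

Lemma largestK_norm_signed_indic d (T : measurableType d) (R : realType)
    (mu : {measure set T -> \bar R}) (K : R) (v : L1fun mu) (B : set T) :
  measurable B -> (forall x, `|v x| = \1_B x)%R ->
  largestK_norm K v <= mu B /\ largestK_norm K v <= K%:E.
Proof.
move=> mB vB; have I A : measurable A ->
    \int[mu]_(x in A) `|v x|%:E = mu (B `&` A).
  by move=> mA; under eq_integral do rewrite vB; rewrite integral_indic.
split; apply: largestK_norm_le => A mA AK; rewrite I//.
  by apply: le_measure; rewrite ?inE//; exact: measurableI.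
by apply: le_trans AK; apply: le_measure; rewrite ?inE//; exact: measurableI.
Qed.

Lemma dual_ball_bounds d (T : measurableType d) (R : realType)
    (mu : {sigma_finite_measure set T -> \bar R}) (K : R) (s : T -> R) :
  atom_free mu -> (0 < K)%R -> measurable_fun setT s ->
  (forall v : L1fun mu, \int[mu]_x (s x * v x)%:E <= largestK_norm K v) ->
  (\forall x \ae mu, `|s x| <= 1)%R /\ \int[mu]_x `|s x|%:E <= K%:E.
Proof.
move=> af K0 ms sK.
have mas : measurable_fun setT (fun x => `|s x|%R) by apply: measurableT_comp.
have mEs D : measurable_fun D (fun x => `|s x|%:E).
  by apply/measurable_EFinP/measurable_funTS.
have test B : measurable B -> mu B < +oo ->
    \int[mu]_(x in B) `|s x|%:E <= mu B /\ \int[mu]_(x in B) `|s x|%:E <= K%:E.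
  move=> mB Boo; have [v vB] := signed_indic ms mB Boo.
  have [vmu vK] :=
    @largestK_norm_signed_indic _ _ _ mu K v B mB (fun x => (vB x).1).
  have := sK v; under eq_integral do rewrite (vB _).2.
  by rewrite -integral_mul_indic => h; split; exact: le_trans h _.
split.
  pose F := [set x | 1 < `|s x|]%R.
  have mF : measurable F.
    by rewrite /F -preimage_itvoy -[X in measurable X]setTI; exact: mas.
  suff F0 : mu F = 0.
    by exists F; split => // x /= /negP; rewrite -ltNge.
  apply/eqP; rewrite eq_le measure_ge0 andbT leNgt; apply/negP => F0.
  (* On such a [B], where [|s| > 1], the integral of [|s|] strictly exceeds the finite [mu B],
     contradicting [test]. *)
  have [B [mB BF B0 BK]] := sigma_finite_atom_free_small af mF F0 K0.
  have Boo : mu B < +oo by apply: le_lt_trans BK _; rewrite ltry.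
  have [+ _] := test B mB Boo.
  have ms1 : measurable_fun setT (fun x => `|s x| - 1)%R.
    exact: measurable_funB.
  have I0 : 0 < \int[mu]_(x in B) (`|s x| - 1)%:E.
    by apply: integral_gt0 => // x /BF; rewrite subr_gt0.
  have -> : \int[mu]_(x in B) `|s x|%:E =
      \int[mu]_(x in B) ((`|s x| - 1)%:E + 1%:E).
    by apply: eq_integral => x _; rewrite -EFinD subrK.
  rewrite ge0_integralD//; last 2 first.
  - by move=> x /BF/ltW; rewrite lee_fin subr_ge0.
  - exact/measurable_EFinP/measurable_funTS.
  rewrite integral_cst// mul1e leNgt => /negP; apply.
  by rewrite lteDr// ge0_fin_numE.
(* The bound [K] is uniform over sets of finite measure, so it passes to the whole space along an
   increasing exhaustion. *)
have [F [FT ndF mF]] := (sigma_finiteP _ _).1 (sigma_finiteT mu).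
rewrite FT.
have cI : \int[mu]_(x in F n) `|s x|%:E @[n --> \oo] -->
    \int[mu]_(x in \bigcup_n F n) `|s x|%:E.
  by apply: ge0_nondecreasing_set_cvg_integral => // n; exact: (mF n).1.
rewrite -(cvg_lim _ cI)//; apply: lime_le.
  by apply/cvg_ex; exists (\int[mu]_(x in \bigcup_n F n) `|s x|%:E).
by apply: nearW => n; exact: (test _ (mF n).1 (mF n).2).2.
Qed.

(** * Norm bounds, integrability and the subdifferentials *)

(** Positivity of [mu setT] selects the essential supremum in the definition of the sup norm. *)
Lemma Lnorm_boundsP d (T : measurableType d) (R : realType)
    (mu : {measure set T -> \bar R}) (K c : R) (s : T -> R) :
  0 < mu setT ->
  ('N[mu]_+oo[EFin \o s] <= c%:E /\ 'N[mu]_1[EFin \o s] <= (c * K)%:E) <->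
  ((\forall x \ae mu, `|s x| <= c)%R /\ \int[mu]_x `|s x|%:E <= (c * K)%:E).
Proof.
move=> T0; rewrite Lnorm1 unlock T0.
split=> -[sc sK]; split => //.
  by move/ess_supP : sc; apply: filterS => x; rewrite /= lee_fin.
by apply/ess_supP; apply: filterS sc => x; rewrite /= lee_fin.
Qed.

(** The radius [c] stays general: [c = 1] describes the dual unit ball, while [c < 1] excludes
    subgradients of smaller norm at a nonzero [u]. *)
Lemma integral_mul_abs_bounds d (T : measurableType d) (R : realType)
    (mu : {measure set T -> \bar R}) (K c : R) (s : T -> R) (v : L1fun mu) :
  atom_free mu -> (0 < K)%R -> (0 <= c)%R -> measurable_fun setT s ->
  (\forall x \ae mu, `|s x| <= c)%R -> \int[mu]_x `|s x|%:E <= (c * K)%:E ->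
  mu.-integrable setT (fun x => (s x * v x)%:E) /\
  \int[mu]_x (s x * v x)%:E <= c%:E * largestK_norm K v.
Proof.
move=> af K0 c0 ms sc scK.
have msv : measurable_fun setT (fun x => (s x * v x)%:E).
  by apply/measurable_EFinP; exact: measurable_funM.
have le := integral_abs_le_largestK_norm v af K0 c0 ms sc scK.
split; last first.
  by apply: le_trans le; apply: le_trans (le_abse_integral mu measurableT msv);
     exact: lee_abs.
apply/integrableP; split => //; apply: le_lt_trans le _.
rewrite -ge0_fin_numE ?fin_numM ?largestK_norm_fin//.
by rewrite mule_ge0 ?lee_fin ?largestK_norm_ge0.
Qed.

(** Integrability of the products justifies the linearity of the integral in the subgradient
    inequality. *)
Lemma dual_ball_integrable d (T : measurableType d) (R : realType)
    (mu : {sigma_finite_measure set T -> \bar R}) (K : R) (s : T -> R)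
    (u : L1fun mu) :
  atom_free mu -> (0 < K)%R -> measurable_fun setT s ->
  (forall v : L1fun mu, \int[mu]_x (s x * v x)%:E <= largestK_norm K v) ->
  mu.-integrable setT (fun x => (s x * u x)%:E).
Proof.
move=> af K0 ms sv; have [s1 sK] := dual_ball_bounds af K0 ms sv.
rewrite -[K]mul1r in sK.
exact: (integral_mul_abs_bounds u af K0 ler01 ms s1 sK).1.
Qed.

Lemma max_norm_leP d (T : measurableType d) (R : realType)
    (mu : {measure set T -> \bar R}) (K c : R) (s : T -> R) :
  (0 < K)%R ->
  maxe 'N[mu]_+oo[EFin \o s] (K^-1%:E * 'N[mu]_1[EFin \o s]) <= c%:E <->
  'N[mu]_+oo[EFin \o s] <= c%:E /\ 'N[mu]_1[EFin \o s] <= (c * K)%:E.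
Proof.
by move=> K0; rewrite ge_max lee_pdivrMl// -EFinM mulrC; split => /andP.
Qed.

Theorem theorem3p15 (d : measure_display) (T : measurableType d) (R : realType)
    (mu : {sigma_finite_measure set T -> \bar R}) (mu_atom_free : atom_free mu)
    (u : L1fun mu) (u_neq0 : ~ (ae_eq mu setT u (cst 0%R)))
    (K : R) (K_gt0 : (0 < K)%R) (K_lt : K%:E < mu setT) :
  subdifferential (largestK_norm K) (0%R : L1fun mu) =
    [set s : Linfty_fun mu |
       'N[mu]_+oo[EFin \o s] <= 1 /\ 'N[mu]_1[EFin \o s] <= K%:E]
  /\
  subdifferential (largestK_norm K) u =
    [set s : Linfty_fun mu |
       maxe 'N[mu]_+oo[EFin \o s] (K^-1%:E * 'N[mu]_1[EFin \o s]) = 1 /\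
       \int[mu]_x (s x * u x)%:E = largestK_norm K u].
Proof.
have T0 : 0 < mu setT by apply: le_lt_trans K_lt; rewrite lee_fin ltW.
(* Since the norm of 0 is 0, this equivalence is already the formula at 0; the formula at [u] uses
   it in both directions. *)
have ballP (s : Linfty_fun mu) :
    ('N[mu]_+oo[EFin \o s] <= 1 /\ 'N[mu]_1[EFin \o s] <= K%:E) <->
    forall v : L1fun mu, \int[mu]_x (s x * v x)%:E <= largestK_norm K v.
  rewrite -[K in X in _ /\ X]mul1r Lnorm_boundsP//; split=> [[s1 sK] v|sv].
    rewrite -[leRHS]mul1e.
    exact: (integral_mul_abs_bounds v mu_atom_free K_gt0 ler01 _ s1 sK).2.
  by rewrite mul1r; exact: dual_ball_bounds.
split; rewrite eqEsubset; split => s /=;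
  have ms : measurable_fun setT s := @measurable_funPT _ _ _ _ s.
- move=> sub; apply/ballP => v.
  by have := sub v; rewrite subr0 largestK_norm0// sube0.
- move=> /ballP sv v; rewrite subr0 largestK_norm0// sube0; exact: sv.
- move=> sub.
  have sv (v : L1fun mu) : \int[mu]_x (s x * v x)%:E <= largestK_norm K v.
    have := sub (u + v)%R; rewrite addrAC subrr add0r => /le_trans; apply.
    by rewrite leeBlDl ?largestK_norm_fin// largestK_normD.
  have intsu := dual_ball_integrable u mu_atom_free K_gt0 ms sv.
  (* One inequality is [sv] at [u]; the other is the subgradient inequality tested at [v = 0]. *)
  have su : \int[mu]_x (s x * u x)%:E = largestK_norm K u.
    apply/eqP; rewrite eq_le sv/=.
    have := sub 0%R; rewrite largestK_norm0// sub0e sub0r.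
    under eq_integral do rewrite /= mulrN EFinN.
    by rewrite integralN ?integrable_add_def// leeN2.
  split => //; apply/eqP; rewrite eq_le; apply/andP; split.
    by apply/(max_norm_leP _ _ _ K_gt0); rewrite mul1r; exact/ballP.
  rewrite leNgt; apply/negP; set m := maxe _ _ => m1.
  have m0 : 0 <= m by rewrite le_max Lnorm_ge0.
  (* Being below 1, [m] is finite, so its real value can serve as the radius [c]. *)
  have mE : m = (fine m)%:E.
    by rewrite fineK// ge0_fin_numE// (lt_trans m1)// ltry.
  have /(max_norm_leP _ _ _ K_gt0)/(Lnorm_boundsP _ _ _ T0)[sc scK] :
    m <= (fine m)%:E by rewrite -mE.
  have [_] :=
    integral_mul_abs_bounds u mu_atom_free K_gt0 (fine_ge0 m0) ms sc scK.
  rewrite su -mE leNgt => /negP; apply.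
  by rewrite -[ltRHS]mul1e lte_pmul2r ?largestK_norm_fin ?largestK_norm_gt0.
- move=> [max1 su].
  have /(max_norm_leP _ _ _ K_gt0) :
    maxe 'N[mu]_+oo[EFin \o s] (K^-1%:E * 'N[mu]_1[EFin \o s]) <= 1%:E.
    by rewrite max1.
  rewrite mul1r => /ballP sv v.
  (* The integral of [s (v - u)] splits, and its second part is the norm of [u] by [su]; the claim
     reduces to [sv]. *)
  have ints w := dual_ball_integrable w mu_atom_free K_gt0 ms sv.
  under eq_integral do rewrite mulrBr EFinB.
  by rewrite (integralB_EFin measurableT (ints v) (ints u)) su leeB.
Qed.
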